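(* Every regular fusible module over a right duo ring is reduced.
   Context: Rings are associative with identity; modules are unital right modules. A ring $R$ is right duo if $Ra\subseteq aR$ for every $a\in R$. Let $M$ be a right $R$-module. For $m\in M$, $ann_R(m)=\{r\in R: mr=0\}$. $T_R(M)=\{m\in M: ann_R(m)\neq 0\}$ is the set of torsion elements, $T_R^{\star}(M)=\{m\in M: ann_R(m)=0\}$ the set of torsion free elements, and $Zd(M)=\{r\in R: mr=0\text{ for some }0\neq m\in M\}$. An element of $M$ is fusible if it can be written as $x+y$ with $x\in T_R(M)$ and $y\in T_R^{\star}(M)$. A nonzero $m\in M$ is regular fusible if there exists $r\in R-Zd(M)$ such that $mr$ is fusible; $M$ is a regular fusible module if every nonzero element of $M$ is regular fusible. $M$ is reduced if for every $m\in M$ and $r\in R$ with $mr=0$ one has $mR\cap Mr=0$, where $Mr=\{nr: n\in M\}$. *)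

(* Defs.v *)
From HB Require Import structures.
From mathcomp Require Import all_boot all_order all_algebra.
From mathcomp Require Import classical_sets.

Set Implicit Arguments.
Unset Strict Implicit.
Unset Printing Implicit Defensive.

Import GRing.Theory.
Local Open Scope classical_set_scope.
Local Open Scope ring_scope.

(* Rings are [pzRingType] (the zero ring is allowed). A right
   R-module is a left module over the converse ring R^c; [m *> r] is the right
   action of r on m, and [ractM] below checks that it is on the correct side. *)
Definition ract (R : pzRingType) (M : lmodType R^c) (m : M) (r : R) : M :=
  (r : R^c) *: m.

Notation "m *> r" := (ract m r) (at level 40, left associativity) : ring_scope.

Lemma ractM (R : pzRingType) (M : lmodType R^c) (m : M) (r s : R) :
  m *> (r * s) = m *> r *> s.
Proof. by rewrite /ract scalerA. Qed.

Lemma ract1 (R : pzRingType) (M : lmodType R^c) (m : M) : m *> (1 : R) = m.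
Proof. exact: scale1r. Qed.

Definition right_duo (R : pzRingType) : Prop :=
  forall a : R, [set r * a | r in [set: R]] `<=` [set a * r | r in [set: R]].

Section RightModule.
Variables (R : pzRingType) (M : lmodType R^c).

Definition ann (m : M) : set R := [set r | m *> r = 0].

Definition torsion : set M := [set m | ann m <> [set 0]].

Definition torsion_free : set M := [set m | ann m = [set 0]].

Definition Zd : set R := [set r | exists2 m : M, m <> 0 & m *> r = 0].

Definition fusible (m : M) : Prop :=
  exists x y : M, [/\ torsion x, torsion_free y & m = x + y].

Definition regular_fusible (m : M) : Prop :=
  m <> 0 /\ exists2 r : R, (~` Zd) r & fusible (m *> r).

End RightModule.

Definition regular_fusible_module (R : pzRingType) (M : lmodType R^c) : Prop :=
  forall m : M, m <> 0 -> regular_fusible m.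

Definition reduced_module (R : pzRingType) (M : lmodType R^c) : Prop :=
  forall (m : M) (r : R), m *> r = 0 ->
    [set m *> s | s in [set: R]] `&` [set n *> r | n in [set: M]] = [set 0].

(* Main.v *)
Require Import Defs.
From mathcomp Require Import all_boot all_order all_algebra.
From mathcomp Require Import classical_sets.

Import GRing.Theory.
Local Open Scope ring_scope.

(** Over a right duo ring annihilators of elements absorb multiplication on
    both sides: if [m r = 0] then [m s r = m r s' = 0] (lemma [ract_duo0]).
    Suppose [m r = 0] and [w = m s = n r] is nonzero.  Some multiple
    [u = w c] is fusible, and it satisfies [u r = 0] (because [u] is a multiple
    of [m]) while also [u] lies in [n r R].  These two properties prevent [u]
    from being fusible.  Write [u = x + y] with [x t = 0] and [y] torsion free.
    Both [x] and [u] kill [r t], hence so does [y], and [r t = 0].  Then [u],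
    being in [n r R], is killed by [t]; so [y t = u t - x t = 0] and [t = 0].
    Thus [x] cannot be torsion (lemma [not_fusible_ann_mul]). *)

Lemma ractDl (R : pzRingType) (M : lmodType R^c) (m n : M) (r : R) :
  (m + n) *> r = m *> r + n *> r.
Proof. exact: scalerDr. Qed.

Lemma ract0l (R : pzRingType) (M : lmodType R^c) (r : R) : (0 : M) *> r = 0.
Proof. exact: scaler0. Qed.

Lemma ract0r (R : pzRingType) (M : lmodType R^c) (m : M) : m *> (0 : R) = 0.
Proof. exact: scale0r. Qed.

Lemma ract_duo0 (R : pzRingType) (M : lmodType R^c) (m : M) (r s : R) :
  right_duo R -> m *> r = 0 -> m *> s *> r = 0.
Proof.
move=> duoR mr0.
have [s' _ rs'] : [set r * a | a in [set: R]]%classic (s * r).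
  by apply: duoR; exists s.
by rewrite -ractM -rs' ractM mr0 ract0l.
Qed.

(** The mechanism behind the theorem: a torsion summand of [u] has an
    annihilator [t] that is forced first to satisfy [r t = 0], by [u r = 0],
    and then to kill [u] itself, since [u] is in [n r R]. *)
Lemma not_fusible_ann_mul (R : pzRingType) (M : lmodType R^c)
    (n : M) (r c : R) :
  right_duo R -> n *> r *> c *> r = 0 -> ~ fusible (n *> r *> c).
Proof.
move=> duoR ur0 [x [y [xT yTF uE]]]; apply: xT.
have y_inj a : y *> a = 0 -> a = 0.
  by move=> ya0; have : ann y a by []; rewrite yTF.
apply/seteqP; split=> t /= => [xt0|->]; last exact: ract0r.
have rt0 : r * t = 0.
  apply: y_inj; have : (x + y) *> r *> t = 0 by rewrite -uE ur0 ract0l.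
  by rewrite !ractDl (ract_duo0 _ _ _ _ _ duoR xt0) add0r ractM.
apply: y_inj; have : (x + y) *> t = 0.
  by rewrite -uE; apply: ract_duo0; rewrite // -ractM rt0 ract0r.
by rewrite ractDl xt0 add0r.
Qed.

Theorem theorem3 (R : pzRingType) (M : lmodType R^c) :
  right_duo R -> regular_fusible_module M -> reduced_module M.
Proof.
move=> duoR rfM m r mr0; apply/seteqP; split=> [w [[s _ msw] [n _ nrw]]|w /= ->].
  have [w0|/eqP w0] := eqVneq w 0; first exact: w0.
  have [_ [c _ ]] := rfM w w0.
  have wcr0 : w *> c *> r = 0 by rewrite -msw -(ractM m s c); apply: ract_duo0.
  by rewrite -nrw => /(not_fusible_ann_mul _ _ _ _ _ duoR) []; rewrite nrw.
by split; [exists 0; rewrite ?ract0r | exists 0; rewrite ?ract0l].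
Qed.
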